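(* Let $\mathbf{A}\in\mathbb{C}^{m\times n}$ have rank $r\ge1$, and suppose that $r<\min\{m,n\}$ or $r=m<n$. Then the projection matrix $\mathbf{P}=\mathbf{A}^{+}\mathbf{A}$ can be represented as $$\mathbf{P}=\left(\frac{p_{ij}}{d_{r}(\mathbf{A}^{*}\mathbf{A})}\right)_{n\times n},\qquad p_{ij}=\sum_{\beta\in J_{r,n}\{i\}}\left|\left((\mathbf{A}^{*}\mathbf{A})_{.\,i}(\mathbf{d}_{.j})\right)^{\beta}_{\beta}\right|\quad (1\le i,j\le n),$$ where $\mathbf{d}_{.j}$ denotes the $j$th column of $\mathbf{A}^{*}\mathbf{A}$.
   Context: $\mathbf{A}^{*}$ is the conjugate transpose of $\mathbf{A}$. $\mathbf{A}^{+}\in\mathbb{C}^{n\times m}$ is the Moore–Penrose inverse, the unique matrix with $\mathbf{A}\mathbf{A}^{+}\mathbf{A}=\mathbf{A}$, $\mathbf{A}^{+}\mathbf{A}\mathbf{A}^{+}=\mathbf{A}^{+}$, $(\mathbf{A}\mathbf{A}^{+})^{*}=\mathbf{A}\mathbf{A}^{+}$, $(\mathbf{A}^{+}\mathbf{A})^{*}=\mathbf{A}^{+}\mathbf{A}$. $\mathbf{B}_{.\,i}(\mathbf{b})$ is the matrix obtained from $\mathbf{B}$ by replacing its $i$th column by the column vector $\mathbf{b}$. For $1\le r\le n$, $J_{r,n}$ is the set of all strictly increasing sequences of $r$ integers chosen from $\{1,\dots,n\}$, and $J_{r,n}\{i\}$ is the set of those $\beta\in J_{r,n}$ containing $i$.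 $|\mathbf{B}^{\beta}_{\beta}|$ is the principal minor of the square matrix $\mathbf{B}$ with rows and columns indexed by $\beta$. $d_{r}(\mathbf{A}^{*}\mathbf{A})=\sum_{\beta\in J_{r,n}}|(\mathbf{A}^{*}\mathbf{A})^{\beta}_{\beta}|$. *)

(* Defs.v *)
From mathcomp Require Import all_boot all_order all_algebra.
From mathcomp Require Import complex reals.

Set Implicit Arguments.
Unset Strict Implicit.
Unset Printing Implicit Defensive.

Import Order.TTheory GRing.Theory Num.Theory.
Local Open Scope ring_scope.
Local Open Scope sesquilinear_scope.

Definition moore_penrose (C : numClosedFieldType) (m n : nat)
    (A : 'M[C]_(m, n)) (X : 'M[C]_(n, m)) : bool :=
  [&& A *m X *m A == A,
      X *m A *m X == X,
      (A *m X)^t* == A *m X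
    & (X *m A)^t* == X *m A].

Lemma adjmxM (C : numClosedFieldType) (m n p : nat)
    (A : 'M[C]_(m, n)) (B : 'M[C]_(n, p)) : (A *m B)^t* = B^t* *m A^t*.
Proof. by rewrite trmx_mul map_mxM. Qed.

Lemma gram_eq0 (C : numClosedFieldType) (m n : nat) (A : 'M[C]_(m, n)) :
  A *m A^t* = 0 -> A = 0.
Proof.
move=> /matrixP A0; apply/matrixP => i j; rewrite mxE.
have := A0 i i; rewrite !mxE => /eqP.
rewrite psumr_eq0 => [/allP /(_ j)|k _]; last by rewrite !mxE mul_conjC_ge0.
by rewrite mem_index_enum !mxE mul_conjC_eq0 => /(_ isT) /eqP.
Qed.

Lemma gram_unitmx (C : numClosedFieldType) (m n : nat) (A : 'M[C]_(m, n)) :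
  row_free A -> A *m A^t* \in unitmx.
Proof.
move=> freeA; rewrite -row_free_unit -kermx_eq0; apply/eqP.
set K := kermx _; have K0 : K *m (A *m A^t*) = 0 by exact: mulmx_ker.
apply/eqP; rewrite -(mulmx_free_eq0 _ freeA); apply/eqP/gram_eq0.
by rewrite adjmxM mulmxA -(mulmxA K) K0 mul0mx.
Qed.

Lemma moore_penrose_mul (C : numClosedFieldType) (m k n : nat)
    (L : 'M[C]_(m, k)) (W : 'M[C]_(k, n)) :
    L^t* *m L \in unitmx -> W *m W^t* \in unitmx ->
  moore_penrose (L *m W)
    (W^t* *m invmx (W *m W^t*) *m (invmx (L^t* *m L) *m L^t*)).
Proof.
set G := W *m W^t*; set H := L^t* *m L => uH uG; set X := _ *m (_ *m _).
have GV : (invmx G)^t* = invmx G.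
  by rewrite trmx_inv map_invmx /G adjmxM trmxCK.
have HV : (invmx H)^t* = invmx H.
  by rewrite trmx_inv map_invmx /H adjmxM trmxCK.
have AX : L *m W *m X = L *m invmx H *m L^t*.
  by rewrite /X -!mulmxA (mulmxA W) -/G (mulmxA G) (mulmxV uG) mul1mx.
have XA : X *m (L *m W) = W^t* *m invmx G *m W.
  by rewrite /X -!mulmxA (mulmxA (L^t*)) -/H (mulmxA (invmx H)) (mulVmx uH) mul1mx.
apply/and4P; split; apply/eqP.
- rewrite AX -!mulmxA (mulmxA (L^t*)) -/H (mulmxA (invmx H)) (mulVmx uH).
  by rewrite mul1mx.
- by rewrite XA /X -!mulmxA (mulmxA W) -/G (mulmxA G) (mulmxV uG) mul1mx.
- by rewrite AX !adjmxM trmxCK HV mulmxA.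
- by rewrite XA !adjmxM trmxCK GV mulmxA.
Qed.

Lemma moore_penrose_exists (C : numClosedFieldType) (m n : nat)
  (A : 'M[C]_(m, n)) : exists X, moore_penrose A X.
Proof.
have uL : (col_base A)^t* *m col_base A \in unitmx.
  rewrite -{2}[col_base A]trmxCK; apply: gram_unitmx.
  by rewrite /row_free mxrank_map mxrank_tr; exact: col_base_full.
have uW : row_base A *m (row_base A)^t* \in unitmx.
  by apply/gram_unitmx/row_base_free.
by have := moore_penrose_mul uL uW; rewrite mulmx_base => mpX; eexists; exact: mpX.
Qed.

Lemma moore_penrose_unique (C : numClosedFieldType) (m n : nat)
    (A : 'M[C]_(m, n)) (X Y : 'M[C]_(n, m)) :
  moore_penrose A X -> moore_penrose A Y -> X = Y.
Proof.
move=> /and4P[/eqP X1 /eqP X2 /eqP X3 /eqP X4].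
move=> /and4P[/eqP Y1 /eqP Y2 /eqP Y3 /eqP Y4].
have AXY : A *m X = A *m Y.
  have -> : A *m X = (A *m Y) *m (A *m X) by rewrite mulmxA Y1.
  by rewrite -{1}Y3 -{1}X3 -adjmxM mulmxA X1 Y3.
have XYA : X *m A = Y *m A.
  have -> : X *m A = (X *m A) *m (Y *m A) by rewrite -mulmxA (mulmxA A) Y1.
  by rewrite -{1}Y4 -{1}X4 -adjmxM -mulmxA (mulmxA A) X1 Y4.
by rewrite -X2 XYA -mulmxA AXY mulmxA Y2.
Qed.

(* A^+ *)
Definition mpinv (C : numClosedFieldType) (m n : nat) (A : 'M[C]_(m, n)) :
  'M[C]_(n, m) := xchoose (moore_penrose_exists A).

Lemma mpinvP (C : numClosedFieldType) (m n : nat) (A : 'M[C]_(m, n)) :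
  moore_penrose A (mpinv A).
Proof. exact: xchooseP. Qed.

(* B_{.i}(b) *)
Definition replace_col (R : Type) (m n : nat) (B : 'M[R]_(m, n)) (i : 'I_n)
    (b : 'cV[R]_m) : 'M[R]_(m, n) :=
  \matrix_(k, l) (if l == i then b k 0 else B k l).

(* J_{r,n}, with {1, .., n} shifted to 'I_n = {0, .., n - 1} *)
Definition incseqs (r n : nat) : {set r.-tuple 'I_n} :=
  [set b : r.-tuple 'I_n | sorted ltn (map val b)].

Definition principal_minor (R : comNzRingType) (r n : nat) (B : 'M[R]_n)
    (b : r.-tuple 'I_n) : R := \det (mxsub (tnth b) (tnth b) B).

Definition sum_principal_minors (R : comNzRingType) (r n : nat) (B : 'M[R]_n) :
  R := \sum_(b in incseqs r n) principal_minor B b.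

(* The sum over J_{r,n}{i} is the sum over the b in J_{r,n} that contain i. *)
Definition proj_num (C : numClosedFieldType) (m n r : nat) (A : 'M[C]_(m, n))
    (i j : 'I_n) : C :=
  \sum_(b in incseqs r n | i \in b)
    principal_minor (replace_col (A^t* *m A) i (col j (A^t* *m A))) b.

(* Main.v *)
Require Import Defs.
From mathcomp Require Import all_boot all_order all_algebra.
From mathcomp Require Import fingroup perm.
From mathcomp Require Import complex reals.

(** A rank factorization A = L W, with L of full column rank and W of full row
    rank r, turns the claim into a statement about r x r determinants. Write X'
    for the conjugate transpose of X, and put H = L' L and K = W' H. Then
    A' A = K W, and the projection is
      P = W' (W W')^-1 W = K (W K)^-1 W,
    because the factor H cancels.

    An r x r minor of K W is a product of a minor of W and a minor of K, so the
    Cauchy-Binet formula [cauchy_binet] gives d_r(A' A) = det (W K). Replacing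
    column i of K W by its column j amounts to replacing column i of W by its
    column j, so the numerator p_ij is the part of the Cauchy-Binet expansion
    of det (V K) that comes from the index sets containing i, where V is W
    with column i replaced by c = W e_j. The remaining part does not see c; it
    is the value of the same determinant for c = 0. Since V - W has at most one
    nonzero column, det (V K) is an affine function of c, and subtracting its
    value at 0 leaves det (W K) times the i-th entry of K (W K)^-1 c: this is Cramer's
    rule in the form [cramer_sum_minors]. At c = W e_j that entry is P_ij. *)

Set Implicit Arguments.
Unset Strict Implicit.
Unset Printing Implicit Defensive.

Import Order.TTheory GRing.Theory Num.Theory.
Local Open Scope ring_scope.
Local Open Scope sesquilinear_scope.

Lemma incseqs_inj (r n : nat) (b : r.-tuple 'I_n) :
  b \in incseqs r n -> injective (tnth b).
Proof.
rewrite inE => sb; apply/tuple_uniqP.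
rewrite -(map_inj_uniq val_inj).
exact: (sorted_uniq ltn_trans ltnn).
Qed.

Lemma incseqs_eq (r n : nat) (b c : r.-tuple 'I_n) :
  b \in incseqs r n -> c \in incseqs r n -> b =i c -> b = c.
Proof.
rewrite !inE => sb sc eq_bc; apply/val_inj/(inj_map val_inj).
by apply: (irr_sorted_eq ltn_trans ltnn sb sc) => x; apply: eq_mem_map.
Qed.

Lemma mem_tuple_perm (r n : nat) (b : r.-tuple 'I_n) (s : 'S_r) x :
  (x \in b) = (x \in codom (fun i => tnth b (s i))).
Proof.
apply/tnthP/codomP => [[i ->]|[i ->]]; last by exists (s i).
by exists ((s^-1)%g i); rewrite permKV.
Qed.

Lemma incseqs_factor (r n : nat) (f : 'I_r -> 'I_n) :
  injective f ->
  exists2 b, b \in incseqs r n & exists s : 'S_r, forall i, f i = tnth b (s i).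
Proof.
move=> injf; pose t := [tuple f i | i < r].
pose b := [tuple of sort (relpre val leq) t].
have permb : perm_eq t b by rewrite perm_sym perm_sort.
exists b.
  rewrite inE ltn_sorted_uniq_leq (map_inj_uniq val_inj) -(perm_uniq permb).
  rewrite map_inj_uniq // enum_uniq /= sorted_map.
  by apply: sort_sorted => x y; apply: leq_total.
have /tuple_permP[s ts] := permb; exists s => i.
have /val_inj tE := ts.
by rewrite -[LHS](tnth_mktuple f) -/t tE tnth_mktuple.
Qed.

(** An injection from 'I_r to 'I_n is, in exactly one way, a permutation of 'I_r
    followed by the increasing enumeration of its image. *)
Lemma sum_inj_incseqs (V : nmodType) (r n : nat)
    (F : {ffun 'I_r -> 'I_n} -> V) :
  \sum_(f : {ffun 'I_r -> 'I_n} | injectiveb f) F f =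
  \sum_(b in incseqs r n) \sum_(s : 'S_r) F [ffun i => tnth b (s i)].
Proof.
pose h (p : r.-tuple 'I_n * 'S_r) := [ffun i => tnth p.1 (p.2 i)].
rewrite pair_big_dep /=.
rewrite -(@big_imset _ _ _ _ _ h [pred p | (p.1 \in incseqs r n) && true] F).
  apply: eq_bigl => f; apply/injectiveP/imsetP => [injf | [[b s]]].
    have [b bI [s fE]] := incseqs_factor injf.
    exists (b, s); first by rewrite unfold_in /= bI.
    by apply/ffunP => i; rewrite ffunE fE.
  rewrite unfold_in /= andbT => bI -> i j; rewrite !ffunE /=.
  by move=> /(incseqs_inj bI)/perm_inj.
move=> [b s] [c t] /=; rewrite !unfold_in /= !andbT => bI cI /ffunP eq_h.
have {}eq_h i : tnth b (s i) = tnth c (t i) by have:= eq_h i; rewrite !ffunE.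
have ebc : b = c.
  apply: incseqs_eq => // x.
  by rewrite (mem_tuple_perm b s) (mem_tuple_perm c t) (eq_codom eq_h).
congr (_, _) => //; apply/permP => i.
by apply: (incseqs_inj bI); rewrite eq_h ebc.
Qed.

(** Each row of A *m B is a combination of the rows of B, and the determinant is
    multilinear in the rows; f records which row of B each row picks. *)
Lemma det_mul_sum_ffun (R : comNzRingType) (r n : nat)
    (A : 'M[R]_(r, n)) (B : 'M[R]_(n, r)) :
  \det (A *m B) =
  \sum_(f : {ffun 'I_r -> 'I_n}) (\prod_i A i (f i)) * \det (rowsub f B).
Proof.
under [RHS]eq_bigr => f _ do rewrite big_distrr /=.
rewrite exchange_big; apply: eq_bigr => s _ /=.
under [RHS]eq_bigr => f _ do rewrite mulrCA -big_split /=.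
rewrite -big_distrr /=; congr (_ * _).
under eq_bigr => i _ do rewrite mxE.
rewrite bigA_distr_bigA; apply: eq_bigr => f _.
by apply: eq_bigr => i _; rewrite mxE.
Qed.

(** In the multilinear expansion a non-injective f repeats a row of B and
    contributes 0. The injective ones with a given image differ by a
    permutation s; the sign of s collects their coefficients into a minor
    of A. *)
Theorem cauchy_binet (R : comNzRingType) (r n : nat)
    (A : 'M[R]_(r, n)) (B : 'M[R]_(n, r)) :
  \det (A *m B) =
  \sum_(b in incseqs r n)
    \det (colsub (tnth b) A) * \det (rowsub (tnth b) B).
Proof.
rewrite det_mul_sum_ffun (bigID (fun f : {ffun _} => injectiveb f)) /=.
rewrite [X in _ + X]big1 ?addr0 => [|f]; last first.
  move=> /injectivePn[i [j ij fij]].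
  by rewrite (determinant_alternate ij) ?mulr0 // => k; rewrite !mxE fij.
rewrite sum_inj_incseqs; apply: eq_bigr => b _.
rewrite big_distrl /=; apply: eq_bigr => s _.
have -> : rowsub [ffun i => tnth b (s i)] B = row_perm s (rowsub (tnth b) B).
  by apply/matrixP => i j; rewrite !mxE ffunE.
rewrite row_permE det_mulmx det_perm mulrCA mulrA; congr (_ * _ * _).
by apply: eq_bigr => i _; rewrite !mxE ffunE.
Qed.

(** Both sides are the determinant of the block matrix with diagonal blocks 1
    and off-diagonal blocks - A and B, reduced to block triangular form by
    eliminating either the upper right or the lower left block. It is used below
    with n = 1, where the right-hand side is a scalar. *)
Lemma det_1D_mulC (R : comNzRingType) (m n : nat)
    (A : 'M[R]_(m, n)) (B : 'M[R]_(n, m)) :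
  \det (1%:M + A *m B) = \det (1%:M + B *m A).
Proof.
pose M := block_mx 1%:M (- A) B 1%:M.
have <- : \det M = \det (1%:M + A *m B).
  have : block_mx 1%:M A 0 1%:M *m M = block_mx (1%:M + A *m B) 0 B 1%:M.
    by rewrite mulmx_block !mul1mx !mul0mx !mulmx1 !add0r addNr.
  move/(congr1 determinant); rewrite det_mulmx det_ublock det_lblock.
  by rewrite !det1 !mulr1 mul1r.
have : block_mx 1%:M 0 (- B) 1%:M *m M = block_mx 1%:M (- A) 0 (1%:M + B *m A).
  rewrite mulmx_block !mul1mx !mul0mx !mulmx1 !addr0 addNr mulNmx mulmxN opprK.
  by rewrite addrC.
move/(congr1 determinant); rewrite det_mulmx det_ublock det_lblock.
by rewrite !det1 !mul1r.
Qed.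

(** Column replacement is a perturbation of rank at most one. *)
Lemma replace_colE (R : comNzRingType) (m n : nat) (B : 'M[R]_(m, n)) i b :
  replace_col B i b = B + (b - col i B) *m delta_mx 0 i.
Proof.
apply/matrixP => k l; rewrite !mxE big_ord1 !mxE eqxx eq_sym /=.
by case: eqP => [->|_]; rewrite ?mulr1 ?mulr0 ?addr0 // addrC subrK.
Qed.

Lemma mul_replace_col (R : comNzRingType) (m n p : nat)
    (A : 'M[R]_(m, n)) (B : 'M[R]_(n, p)) i b :
  A *m replace_col B i b = replace_col (A *m B) i (A *m b).
Proof. by rewrite !replace_colE mulmxDr mulmxA mulmxBr colE colE mulmxA. Qed.

(** The matrix determinant lemma: W *m K times 1 plus a rank-one matrix. *)
Lemma det_replace_col_mul (R : comUnitRingType) (r n : nat)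
    (W : 'M[R]_(r, n)) (K : 'M[R]_(n, r)) i c :
  W *m K \in unitmx ->
  \det (replace_col W i c *m K) =
  \det (W *m K) * (1 + (K *m invmx (W *m K) *m (c - col i W)) i 0).
Proof.
move=> uWK; set d := c - _; set N := invmx _.
have -> : replace_col W i c *m K =
          W *m K *m (1%:M + N *m d *m (delta_mx 0 i *m K)).
  rewrite replace_colE mulmxDl mulmxDr mulmx1; congr (_ + _).
  by rewrite !mulmxA mulmxV // mul1mx.
rewrite det_mulmx det_1D_mulC; congr (_ * _).
rewrite det_mx11 mxE mxE; congr (_ + _).
by rewrite -rowE -row_mul mulmxA mxE.
Qed.

(** For r = n and K = 1 this is Cramer's rule. A minor whose index set avoids i
    does not involve c, and a minor whose index set contains i vanishes for
    c = 0; so the left-hand side is the full Cauchy-Binet sum at c minus the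
    full sum at 0. *)
Theorem cramer_sum_minors (R : comUnitRingType) (r n : nat)
    (W : 'M[R]_(r, n)) (K : 'M[R]_(n, r)) i c :
  W *m K \in unitmx ->
  \sum_(b in incseqs r n | i \in b)
    \det (colsub (tnth b) (replace_col W i c)) * \det (rowsub (tnth b) K) =
  \det (W *m K) * (K *m invmx (W *m K) *m c) i 0.
Proof.
move=> uWK.
pose T x b := \det (colsub (tnth b) (replace_col W i x)) *
              \det (rowsub (tnth b) K).
have split_sum x : \det (replace_col W i x *m K) =
    \sum_(b in incseqs r n | i \in b) T x b
    + \sum_(b in incseqs r n | i \notin b) T x b.
  by rewrite cauchy_binet (bigID (fun b : r.-tuple _ => i \in b)).
have in0 : \sum_(b in incseqs r n | i \in b) T 0 b = 0.
  apply: big1 => b /andP[_ /tnthP[j ij]].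
  rewrite /T (expand_det_col _ j) big1 ?mul0r // => k _.
  by rewrite !mxE -ij eqxx mul0r.
have outE : \sum_(b in incseqs r n | i \notin b) T c b =
            \sum_(b in incseqs r n | i \notin b) T 0 b.
  apply: eq_bigr => b /andP[_ ib]; rewrite /T; congr (\det _ * _).
  apply/matrixP => k l; rewrite !mxE; case: eqP => // li.
  by rewrite -li mem_tnth in ib.
have := split_sum c; rewrite outE.
have := split_sum 0; rewrite in0 add0r => <- /eqP.
rewrite -subr_eq => /eqP <-; rewrite !det_replace_col_mul //.
rewrite -mulrBr; congr (_ * _); set M := _ *m invmx _.
have entryB x : (M *m (x - col i W)) i 0 =
    (M *m x) i 0 - (M *m col i W) i 0 by rewrite mulmxBr !mxE.
have entry0 : (M *m (0 : 'cV_r)) i 0 = 0 by rewrite mulmx0 mxE.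
rewrite !entryB entry0 sub0r.
by rewrite opprD addrACA subrr add0r opprK subrK.
Qed.

Lemma principal_minor_mul (R : comNzRingType) (r n : nat)
    (K : 'M[R]_(n, r)) (W : 'M[R]_(r, n)) (b : r.-tuple 'I_n) :
  principal_minor (K *m W) b =
  \det (colsub (tnth b) W) * \det (rowsub (tnth b) K).
Proof. by rewrite /principal_minor mxsub_mul det_mulmx mulrC. Qed.

(** The orthogonal projection on the row space depends on the right factor
    alone. *)
Lemma mpinv_mul (C : numClosedFieldType) (m k n : nat)
    (L : 'M[C]_(m, k)) (W : 'M[C]_(k, n)) :
    L^t* *m L \in unitmx -> W *m W^t* \in unitmx ->
  mpinv (L *m W) *m (L *m W) = W^t* *m invmx (W *m W^t*) *m W.
Proof.
move=> uL uW.
rewrite (moore_penrose_unique (mpinvP _) (moore_penrose_mul uL uW)).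
rewrite -!mulmxA (mulmxA (L^t*)) (mulmxA (invmx (_ *m L))) (mulVmx uL).
by rewrite mul1mx.
Qed.

Theorem mpinv_mul_minors (C : numClosedFieldType) (m n r : nat)
    (L : 'M[C]_(m, r)) (W : 'M[C]_(r, n)) (A := L *m W) :
    L^t* *m L \in unitmx -> W *m W^t* \in unitmx ->
  mpinv A *m A =
    \matrix_(i < n, j < n)
      (proj_num r A i j / sum_principal_minors r (A^t* *m A)).
Proof.
move=> uL uW; pose K := W^t* *m (L^t* *m L).
have gramE : A^t* *m A = K *m W by rewrite adjmxM /K !mulmxA.
have WKE : W *m K = W *m W^t* *m (L^t* *m L) by rewrite /K mulmxA.
have uWK : W *m K \in unitmx by rewrite WKE unitmx_mul uW.
have PE : mpinv A *m A = K *m invmx (W *m K) *m W.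
  rewrite mpinv_mul //; congr (_ *m _).
  (* Both sides become K after right multiplication by the unit W K. *)
  apply: (can_inj (mulmxK uWK)); rewrite mulmxKV //.
  by rewrite WKE [LHS]mulmxA mulmxKV.
have dE : sum_principal_minors r (A^t* *m A) = \det (W *m K).
  rewrite cauchy_binet gramE; apply: eq_bigr => b _.
  exact: principal_minor_mul.
have numE i j : proj_num r A i j =
    \det (W *m K) * (K *m invmx (W *m K) *m col j W) i 0.
  rewrite -cramer_sum_minors // /proj_num gramE; apply: eq_bigr => b _.
  by rewrite colE -mulmxA -colE -mul_replace_col principal_minor_mul.
apply/matrixP => i j; rewrite PE [RHS]mxE dE numE mulrAC mulfV ?mul1r.
  by rewrite [in RHS]colE mulmxA -colE [RHS]mxE.
by rewrite -unitfE -unitmxE.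
Qed.

Theorem corollary2p1 (R : realType) (m n r : nat) (A : 'M[R[i]]_(m, n)) :
  \rank A = r -> (1 <= r)%N ->
  (r < minn m n)%N \/ (r = m /\ (m < n)%N) ->
  mpinv A *m A =
    \matrix_(i < n, j < n)
      (proj_num r A i j / sum_principal_minors r (A^t* *m A)).
Proof.
move=> <- _ _.
have uL : (col_base A)^t* *m col_base A \in unitmx.
  rewrite -{2}[col_base A]trmxCK; apply: gram_unitmx.
  by rewrite /row_free mxrank_map mxrank_tr; exact: col_base_full.
have uW : row_base A *m (row_base A)^t* \in unitmx.
  by apply/gram_unitmx/row_base_free.
by have := mpinv_mul_minors uL uW; rewrite mulmx_base.
Qed.
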